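(* Let $\mathcal O$ be the suboperad of $\mathrm{CNCB}$ generated by $p:=T_{bbu}$ and $q:=T_{uub}$. Then $\mathcal O$ admits the presentation with generators $p,q$ of arity $2$ and relations $$(p\circ_2 p)\circ_2 q=(p\circ_1 q)\circ_1 p,\qquad (q\circ_2 q)\circ_2 p=(q\circ_1 p)\circ_1 q.$$ That is, $\mathcal O$ is isomorphic, via the morphism sending the generators to $p$ and $q$, to the quotient of the free operad on two binary generators by the operadic congruence generated by these two relations.
   Context: For $n\ge2$, a bicoloured noncrossing configuration (BNC) of size $n$ is a regular polygon with vertices $1,\dots,n+1$ clockwise, together with disjoint sets of blue and red arcs among the arcs $(i,j)$, $1\le i<j\le n+1$. The arcs $(i,i+1)$ are the edges ($i$th edge), $(1,n+1)$ is the base, and the others are diagonals. Coloured arcs are pairwise noncrossing ($(i,j),(k,l)$ cross iff $i<k<j<l$ or $k<i<l<j$), and red arcs are diagonals. There is one BNC of size $1$, a blue segment, which is the unit. The operad $\mathrm{CNCB}$ has the BNCs as elements (arity = size). Its composition $\mathfrak C\circ_i\mathfrak D$ ($\mathfrak C$ of size $n$, $\mathfrak D$ of size $m$) glues the base of $\mathfrak D$ on the $i$th edge of $\mathfrak C$. Arcs $(a,b)$ of $\mathfrak C$ become $(\sigma(a),\sigma(b))$ with $\sigma(v)=v$ for $v\le i$ and $v+m-1$ otherwise, and arcs $(a,b)$ of $\mathfrak D$ become $(a+i-1,b+i-1)$, keeping colours. The exception is the arc $(i,i+m)$, which is red if the $i$th edge of $\mathfrak C$ and the base of $\mathfrak D$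 are both uncoloured, blue if both are blue, and uncoloured otherwise. For $x,y,z\in\{b,u\}$, $T_{xyz}$ denotes the BNC of size $2$ (a triangle with vertices $1,2,3$) whose first edge $(1,2)$ has colour $x$, whose base $(1,3)$ has colour $y$, and whose second edge $(2,3)$ has colour $z$, where $b$ = blue and $u$ = uncoloured. The suboperad generated by a set is the smallest suboperad containing it. *)

(* Defs.v *)
From HB Require Import structures.
From mathcomp Require Import all_boot.
Set Implicit Arguments. Unset Strict Implicit. Unset Printing Implicit Defensive.

(* U = uncoloured, B = blue, Rd = red *)
Inductive colour := U | B | Rd.
Definition colour_eqb (a b : colour) : bool :=
  match a, b with U, U | B, B | Rd, Rd => true | _, _ => false end.
Lemma colour_eqP : Equality.axiom colour_eqb.
Proof. by case; case; constructor. Qed.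
HB.instance Definition _ := hasDecEq.Build colour colour_eqP.

Definition arcs_list (n : nat) : seq (nat * nat) :=
  flatten [seq [seq (i, j) | j <- iota i.+1 (n.+1 - i)] | i <- iota 1 n.+1].

(* A configuration: its size n and the list of colours of its arcs, listed in
   the order of [arcs_list n].  This representation is canonical, so
   Leibniz equality is equality of configurations. *)
Record bnc := Bnc { bnc_size : nat; bnc_cols : seq colour }.

(* colour of arc (i,j) (U if (i,j) is not an arc) *)
Definition col (c : bnc) (i j : nat) : colour :=
  nth U (bnc_cols c) (index (i, j) (arcs_list (bnc_size c))).

Definition mkBNC (n : nat) (f : nat -> nat -> colour) : bnc :=
  Bnc n [seq f ij.1 ij.2 | ij <- arcs_list n].

(* Well-formedness (BNC): size >= 1, colours given for all arcs, coloured arcs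
   pairwise noncrossing, red arcs are diagonals; size 1 is the blue segment.
   (Not needed by the theorem, recorded for documentation.) *)
Definition crossing (i j k l : nat) : bool :=
  ((i < k) && (k < j) && (j < l)) || ((k < i) && (i < l) && (l < j)).

Definition is_bnc (c : bnc) : Prop :=
  let n := bnc_size c in
  [/\ 1 <= n, size (bnc_cols c) = size (arcs_list n),
      (n = 1 -> col c 1 2 = B),
      (forall i j k l, (i, j) \in arcs_list n -> (k, l) \in arcs_list n ->
         col c i j != U -> col c k l != U -> ~~ crossing i j k l) &
      (forall i j, col c i j = Rd -> j != i.+1 /\ (i, j) != (1, n.+1))].

Definition unitB : bnc := mkBNC 1 (fun _ _ => B).

(* T_xyz: triangle, first edge (1,2) colour x, base (1,3) colour y,
   second edge (2,3) colour z. *)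
Definition T (x y z : colour) : bnc :=
  mkBNC 2 (fun a b => if (a, b) == (1, 2) then x
                      else if (a, b) == (1, 3) then y
                      else if (a, b) == (2, 3) then z else U).

Definition p : bnc := T B B U.
Definition q : bnc := T U U B.

Definition glue_colour (e b : colour) : colour :=
  match e, b with
  | U, U => Rd
  | B, B => B
  | _, _ => U
  end.

(* Partial composition C o_i D: glue the base of D on the i-th edge of C. *)
Definition ocomp (C : bnc) (i : nat) (D : bnc) : bnc :=
  let n := bnc_size C in
  let m := bnc_size D in
  let inner v := (i < v) && (v < i + m) in
  let sinv v := if v <= i then v else v - m + 1 in
  mkBNC (n + m - 1) (fun a b =>
    if (a == i) && (b == i + m) then glue_colour (col C i i.+1) (col D 1 m.+1)
    else if (i <= a) && (b <= i + m) then col D (a - i + 1) (b - i + 1)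
    else if inner a || inner b then U
    else col C (sinv a) (sinv b)).

Inductive genO : bnc -> Prop :=
  | genO_unit : genO unitB
  | genO_p : genO p
  | genO_q : genO q
  | genO_comp : forall C D i, genO C -> genO D -> 1 <= i <= bnc_size C ->
      genO (ocomp C i D).

Inductive tree := Leaf | NodeP of tree & tree | NodeQ of tree & tree.

Fixpoint arity (t : tree) : nat :=
  match t with
  | Leaf => 1
  | NodeP l r => arity l + arity r
  | NodeQ l r => arity l + arity r
  end.

Fixpoint graft (t : tree) (i : nat) (s : tree) : tree :=
  match t with
  | Leaf => if i == 1 then s else Leaf
  | NodeP l r => if i <= arity l then NodeP (graft l i s) r
                 else NodeP l (graft r (i - arity l) s)
  | NodeQ l r => if i <= arity l then NodeQ (graft l i s) r
                 else NodeQ l (graft r (i - arity l) s)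
  end.

Definition gp : tree := NodeP Leaf Leaf.
Definition gq : tree := NodeQ Leaf Leaf.

Definition rel1_l := graft (graft gp 2 gp) 2 gq.
Definition rel1_r := graft (graft gp 1 gq) 1 gp.
Definition rel2_l := graft (graft gq 2 gq) 2 gp.
Definition rel2_r := graft (graft gq 1 gp) 1 gq.

Inductive cong : tree -> tree -> Prop :=
  | cong_rel1 : cong rel1_l rel1_r
  | cong_rel2 : cong rel2_l rel2_r
  | cong_refl : forall t, cong t t
  | cong_sym : forall t t', cong t t' -> cong t' t
  | cong_trans : forall t t' t'', cong t t' -> cong t' t'' -> cong t t''
  | cong_compl : forall t t' i s, cong t t' -> 1 <= i <= arity t ->
      cong (graft t i s) (graft t' i s)
  | cong_compr : forall t i s s', cong s s' -> 1 <= i <= arity t ->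
      cong (graft t i s) (graft t i s').

Fixpoint ev (t : tree) : bnc :=
  match t with
  | Leaf => unitB
  | NodeP l r => ocomp (ocomp p 2 (ev r)) 1 (ev l)
  | NodeQ l r => ocomp (ocomp q 2 (ev r)) 1 (ev l)
  end.

(* Main.v *)
Require Import Defs.
From mathcomp Require Import all_boot zify.

(* In [ev t] every internal node of [t] is an arc.  Call the type of the corner
   that a subtree fills its state: P for a left child of Q or a right child of P
   (glued on an uncoloured edge), Q otherwise (glued on a blue edge).  The arc of
   a subtree is uncoloured exactly when its root type is its state, so an
   uncoloured arc hides one splitting of a noncrossing piece, and the piece only
   remembers the states of its sides, that is, the parities of the numbers of
   left steps.

   Both relations read a((bc)d) = ((ab)c)d with the types determined by the state.
   Oriented from left to right, they give normal forms in which the right factor of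
   each node is a right comb of sides, and all sides of a comb but the last have the
   same state.  Hence two normal trees with the same arcs split at the same vertex:
   otherwise some side would have two different states. *)

(** * Trees with boolean node types *)

Definition node (x : bool) (l r : tree) : tree := if x then NodeP l r else NodeQ l r.

Lemma tree_node_ind (K : tree -> Prop) :
  K Leaf -> (forall x l r, K l -> K r -> K (node x l r)) -> forall t, K t.
Proof.
move=> K0 KN; elim=> [//|l Kl r Kr|l Kl r Kr]; first exact: (KN true).
exact: (KN false).
Qed.

Lemma arity_node x l r : arity (node x l r) = arity l + arity r.
Proof. by case: x. Qed.

Lemma graft_node x l r i s :
  graft (node x l r) i s =
  if i <= arity l then node x (graft l i s) r else node x l (graft r (i - arity l) s).
Proof. by case: x => /=; case: ifP. Qed.

Lemma arity_gt0 t : 0 < arity t.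
Proof. by elim/tree_node_ind: t => [//|x l r]; rewrite arity_node; lia. Qed.

Lemma arity_graft t i s :
  1 <= i <= arity t -> arity (graft t i s) = arity t + arity s - 1.
Proof.
elim/tree_node_ind: t i => [|x l r IHl IHr] i.
  by move=> /= hi; have -> : i = 1 by [lia]; rewrite eqxx; lia.
rewrite arity_node graft_node => hi; have := arity_gt0 s; have := arity_gt0 l.
by case: ifP => h; rewrite arity_node ?IHl ?IHr; lia.
Qed.

(** * Configurations as colour functions *)

Lemma mem_arcs n i j : ((i, j) \in arcs_list n) = (1 <= i < j) && (j <= n.+1).
Proof.
apply/flatten_mapP/idP => [[k hk /mapP[k' hk' [-> ->]]]|h].
  by rewrite !mem_iota in hk hk'; lia.
by exists i; [|apply/mapP; exists j => //]; rewrite mem_iota; lia.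
Qed.

Lemma col_mkBNC n f i j :
  col (mkBNC n f) i j = if (1 <= i < j) && (j <= n.+1) then f i j else U.
Proof.
rewrite /col /= -mem_arcs; case: ifP => h.
  by rewrite (nth_map (i, j)) ?index_mem // nth_index.
by rewrite nth_default // size_map leqNgt index_mem h.
Qed.

Lemma eq_mkBNC n f g :
  (forall a b, (1 <= a < b) && (b <= n.+1) -> f a b = g a b) -> mkBNC n f = mkBNC n g.
Proof.
move=> fg; congr Bnc; apply/eq_in_map => -[a b]; rewrite mem_arcs; exact: fg.
Qed.

(** * Arc colours of a tree and of a graft *)

Definition edge_colour (s : bool) : colour := if s then U else B.

Definition base_colour (t : tree) : colour := if t is NodeQ _ _ then U else B.

Definition split_colour (v : nat) (f g : nat -> nat -> colour) (a b : nat) : colour :=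
  if b <= v then f a b else if v <= a then g a b else U.

(* Colour of the arc [(a, b)] of [t] when its leftmost vertex is [o] and its base is
   glued on an edge of colour [edge_colour s].  States and types are booleans,
   [true] standing for P and [false] for Q; a Q corner ([s = false]) has a blue
   edge, which is neutral for gluing, so [ev t] is the case [s = false], [o = 1]. *)
Fixpoint arc_colour (s : bool) (t : tree) (o a b : nat) : colour :=
  if (a == o) && (b == o + arity t) then glue_colour (edge_colour s) (base_colour t)
  else match t with
  | Leaf => U
  | NodeP l r =>
    split_colour (o + arity l) (arc_colour false l o) (arc_colour true r (o + arity l)) a b
  | NodeQ l r =>
    split_colour (o + arity l) (arc_colour true l o) (arc_colour false r (o + arity l)) a b
  end.

Lemma arc_colour_node s x l r o a b :
  arc_colour s (node x l r) o a b =
  if (a == o) && (b == o + (arity l + arity r)) then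
    glue_colour (edge_colour s) (edge_colour (~~ x))
  else split_colour (o + arity l) (arc_colour (~~ x) l o)
         (arc_colour x r (o + arity l)) a b.
Proof. by case: x. Qed.

Lemma arc_colour_root s t o :
  arc_colour s t o o (o + arity t) = glue_colour (edge_colour s) (base_colour t).
Proof. by case: t => *; rewrite /= !eqxx. Qed.

Lemma arc_colour_out s t o a b :
  ~~ ((o <= a < b) && (b <= o + arity t)) -> arc_colour s t o a b = U.
Proof.
elim/tree_node_ind: t s o a b => [|x l r IHl IHr] s o a b.
  by move=> /= h; case: ifP => //; lia.
rewrite arity_node arc_colour_node => h; have := arity_gt0 l; have := arity_gt0 r => r0 l0.
rewrite /split_colour; case: ifP => h1; first by lia.
by case: ifP => h2; [apply: IHl|case: ifP => // h3; apply: IHr]; lia.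
Qed.

Lemma arc_colour_shift s t o d a b :
  arc_colour s t (o + d) (a + d) (b + d) = arc_colour s t o a b.
Proof.
elim/tree_node_ind: t s o => [|x l r IHl IHr] s o.
  by rewrite /= eqn_add2r addnAC eqn_add2r.
rewrite !arc_colour_node /split_colour IHl -(addnAC o (arity l) d) IHr.
by rewrite addnAC !eqn_add2r !leq_add2r.
Qed.

Lemma arc_colour_state s s' t o a b :
  ~~ ((a == o) && (b == o + arity t)) -> arc_colour s t o a b = arc_colour s' t o a b.
Proof. by case: t => [|l r|l r] /= /negbTE ->. Qed.

(** The colouring in [ocomp], freed from the two configurations so that [f] may start at any
    offset. *)
Definition glued_colour (i m : nat) (f g : nat -> nat -> colour) (a b : nat) : colour :=
  let inner v := (i < v) && (v < i + m) in
  let sinv v := if v <= i then v else v - m + 1 in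
  if (a == i) && (b == i + m) then glue_colour (f i i.+1) (g 1 m.+1)
  else if (i <= a) && (b <= i + m) then g (a - i + 1) (b - i + 1)
  else if inner a || inner b then U
  else f (sinv a) (sinv b).

(** Induction on [t] needs every state and offset. At a leaf, blue is neutral on either side of the
    gluing: the leaf shows [edge_colour s], and [u] in state [false] shows its own base colour. *)
Lemma arc_colour_graft s t u o i a b : 1 <= i <= arity t -> a < b ->
  arc_colour s (graft t i u) o a b =
  glued_colour (o + i - 1) (arity u) (arc_colour s t o) (arc_colour false u 1) a b.
Proof.
move=> hi ab; have u0 := arity_gt0 u.
elim/tree_node_ind: t s o i hi => [|x l r IHl IHr] s o i.
  move=> /= hi; have -> : i = 1 by lia.
  rewrite /= addnK /glued_colour eqxx.
  have := arc_colour_root false u 1; rewrite add1n => ->.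
  case: ifP => h1.
    have [-> ->] : a = o /\ b = o + arity u by lia.
    rewrite arc_colour_root addn1 !eqxx; by case: s; case: (u).
  case: ifP => h2.
    rewrite (@arc_colour_state s false) ?h1 //.
    have -> : arc_colour false u o a b = arc_colour false u (0 + o) (a - o + o) (b - o + o).
      by congr arc_colour; lia.
    by rewrite arc_colour_shift -(@arc_colour_shift _ _ _ 1).
  rewrite arc_colour_out; last by lia.
  by case: ifP => // h3; case: (leqP a o) => ha; case: (leqP b o) => hb; rewrite ifF //; lia.
rewrite arity_node graft_node => hi; have l0 := arity_gt0 l; have r0 := arity_gt0 r.
case: ifP => hl; rewrite arc_colour_node /split_colour arity_graft; try lia.
  rewrite IHl; last by lia.
  rewrite /glued_colour !arc_colour_node /split_colour.
  (* A graft into [l] moves the right factor by [arity u - 1]. *)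
  have := arc_colour_shift x r (o + arity l) (arity u - 1).
  case: (leqP a (o + i - 1)) => ha; case: (leqP b (o + i - 1)) => hb => shift;
  repeat (case: ifP => ?; try by [|exfalso; lia]).
  by rewrite -shift; congr arc_colour; lia.
rewrite IHr; last by lia.
rewrite /glued_colour !arc_colour_node /split_colour.
have -> : o + arity l + (i - arity l) - 1 = o + i - 1 by lia.
case: (leqP a (o + i - 1)) => ha; case: (leqP b (o + i - 1)) => hb;
by repeat (case: ifP => ?; try by [|exfalso; lia]).
Qed.

Lemma ocomp_arc_colour t i u : 1 <= i <= arity t ->
  ocomp (mkBNC (arity t) (arc_colour false t 1)) i (mkBNC (arity u) (arc_colour false u 1)) =
  mkBNC (arity (graft t i u)) (arc_colour false (graft t i u) 1).
Proof.
move=> hi; rewrite arity_graft //; apply: eq_mkBNC => a b hab.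
have colE v c d : col (mkBNC (arity v) (arc_colour false v 1)) c d = arc_colour false v 1 c d.
  by rewrite col_mkBNC; case: ifP => // h; rewrite arc_colour_out // add1n; lia.
rewrite arc_colour_graft; try lia.
by rewrite /glued_colour /= !colE add1n subn1.
Qed.

Lemma node_graft x l r : node x l r = graft (graft (node x Leaf Leaf) 2 r) 1 l.
Proof. by case: x. Qed.

Lemma ev_arc_colour t : ev t = mkBNC (arity t) (arc_colour false t 1).
Proof.
elim/tree_node_ind: t => [//|x l r IHl IHr].
have -> : ev (node x l r) = ocomp (ocomp (ev (node x Leaf Leaf)) 2 (ev r)) 1 (ev l).
  by case: x => /=; congr (ocomp (ocomp _ _ _) _ _).
rewrite (node_graft x l r) IHl IHr.
have -> : ev (node x Leaf Leaf) =
    mkBNC (arity (node x Leaf Leaf)) (arc_colour false (node x Leaf Leaf) 1) by case: x.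
rewrite !ocomp_arc_colour //; first by case: x.
by have := arity_gt0 r; case: x.
Qed.

(** * Rotation and existence of normal forms *)

Lemma cong_node x l l' r r' : cong l l' -> cong r r' -> cong (node x l r) (node x l' r').
Proof.
move=> hl hr; rewrite (node_graft x l r) (node_graft x l' r').
apply: (cong_trans (t' := graft (graft (node x Leaf Leaf) 2 r') 1 l)).
  apply: cong_compl; last by case: x => /=; have := arity_gt0 r; lia.
  by apply: cong_compr => //; case: x.
by apply: cong_compr => //; case: x => /=; have := arity_gt0 r'; lia.
Qed.

(** The relations are the case of four leaves. The factors are grafted from the last leaf to the
    first, so that the positions still to be filled do not move. *)
Lemma cong_rotate x a b c d :
  cong (node x a (node x (node (~~ x) b c) d)) (node x (node (~~ x) (node x a b) c) d).
Proof.
have graft4 t t' : cong t t' -> arity t = 4 ->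
    cong (graft (graft (graft (graft t 4 d) 3 c) 2 b) 1 a)
         (graft (graft (graft (graft t' 4 d) 3 c) 2 b) 1 a).
  have := arity_gt0 b; have := arity_gt0 c; have := arity_gt0 d => d0 c0 b0 tt' t4.
  do 4 (apply: cong_compl; last by rewrite ?arity_graft ?t4; lia).
  exact: tt'.
by case: x; [exact: (graft4 _ _ cong_rel1)|exact: (graft4 _ _ cong_rel2)].
Qed.

Definition typed (x : bool) (t : tree) : bool :=
  match t with Leaf => false | NodeP _ _ => x | NodeQ _ _ => ~~ x end.

(* [t] is a product [a1 (a2 (... ak))] in state [x] whose factors other than the
   last are leaves or have a coloured arc (type different from their state [~~ x]). *)
Fixpoint comb (x : bool) (t : tree) : bool :=
  match t with
  | Leaf => true
  | NodeP l r => x ==> ~~ typed false l && comb x r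
  | NodeQ l r => ~~ x ==> ~~ typed true l && comb x r
  end.

Fixpoint normal (t : tree) : bool :=
  match t with
  | Leaf => true
  | NodeP l r => [&& normal l, normal r & comb true r]
  | NodeQ l r => [&& normal l, normal r & comb false r]
  end.

Lemma normal_node x l r : normal (node x l r) = [&& normal l, normal r & comb x r].
Proof. by case: x. Qed.

Lemma comb_node x l r : comb x (node x l r) = ~~ typed (~~ x) l && comb x r.
Proof. by case: x. Qed.

Lemma typedP x t : typed x t -> exists l r, t = node x l r.
Proof. by case: t x => [|l r|l r] [] // _; exists l, r. Qed.

Lemma comb_untyped x t : ~~ typed x t -> comb x t.
Proof. by case: t x => [|l r|l r] []. Qed.

(** If the normal tree [r] is not a comb, its first factor is some [node (~~ x) b c]; a rotation
    then leaves [l] to be merged with the smaller tree [b]. *)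
Lemma normal_push x l r : normal l -> normal r ->
  exists2 t, cong (node x l r) t & normal t /\ typed x t.
Proof.
have [n] := ubnP (arity r); elim: n l r => // n IH l r rn nl nr.
have [cr|ncr] := boolP (comb x r).
  by exists (node x l r); [exact: cong_refl|rewrite normal_node nl nr cr; case: (x)].
have /typedP[r1 [d er]] : typed x r by apply: contraNT ncr; exact: comb_untyped.
move: nr ncr rn; rewrite {}er normal_node comb_node arity_node => /and3P[n1 nd cd].
rewrite cd andbT negbK => /typedP[b [c er1]].
move: n1; rewrite {}er1 normal_node arity_node => /and3P[nb nc cc] hn.
have [|t tl [nt _]] := IH l b _ nl nb; first by have := arity_gt0 d; lia.
exists (node x (node (~~ x) t c) d); last by rewrite !normal_node nt nc cc nd cd; case: (x).
apply: cong_trans (cong_rotate _ _ _ _ _) _.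
by do 2 (apply: cong_node; last exact: cong_refl).
Qed.

Lemma normal_exists t : exists2 t', cong t t' & normal t'.
Proof.
elim/tree_node_ind: t => [|x l r [l' ll' nl] [r' rr' nr]].
  by exists Leaf; first exact: cong_refl.
have [t lr [nt _]] := normal_push x l' r' nl nr.
by exists t => //; apply: cong_trans lr; exact: cong_node.
Qed.

(** * States read from colours, and injectivity on normal trees *)

(* The state of the longest side ending at [v] and starting at [lo] or later, where
   [k] bounds the number of arcs examined: blue arcs are sides in state Q, red arcs
   and uncoloured edges are sides in state P. *)
Fixpoint sign_at (f : nat -> nat -> colour) (lo v k : nat) : bool :=
  if k is k'.+1 then
    match f lo v with U => sign_at f lo.+1 v k' | B => false | Rd => true end
  else true.

Lemma sign_at_skip f lo v j k : (forall i, lo <= i < lo + j -> f i v = U) ->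
  sign_at f lo v (j + k) = sign_at f (lo + j) v k.
Proof.
elim: j lo => [|j IH] lo fU; first by rewrite addn0.
rewrite addSn /= fU; last by lia.
by rewrite IH ?addnS // => i hi; apply: fU; lia.
Qed.

Lemma eq_sign_at f g lo v k : (forall i, lo <= i < lo + k -> f i v = g i v) ->
  sign_at f lo v k = sign_at g lo v k.
Proof.
elim: k lo => [//|k IH] lo fg /=; rewrite fg; last by lia.
by rewrite IH // => i hi; apply: fg; lia.
Qed.

(** A coloured base reveals [s]. An uncoloured one means that the root type is [s], which is also
    the state of the right factor, so the search goes on down the right spine. *)
Lemma sign_at_end s t o : sign_at (arc_colour s t o) o (o + arity t) (arity t) = s.
Proof.
elim/tree_node_ind: t s o => [|x l r _ IHr] s o; first by rewrite /= !eqxx; case: s.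
have r0 := arity_gt0 r; have l0 := arity_gt0 l.
have [<-{s}|sx] := eqVneq x s.
  rewrite arity_node sign_at_skip; last first.
    move=> i hi; rewrite arc_colour_node /split_colour.
    case: ifP => _; first by case: (x).
    by rewrite ifF ?ifF //; lia.
  rewrite -[RHS](IHr x (o + arity l)) addnA; apply: eq_sign_at => i hi.
  rewrite arc_colour_node /split_colour ifF; last by lia.
  by rewrite ifF ?ifT //; lia.
rewrite arity_node -[X in sign_at _ _ _ X](@prednK (arity l + arity r)) /=; last by lia.
rewrite arc_colour_node !eqxx.
by case: s x sx {IHr} => [] [].
Qed.

(* Every internal vertex of a comb of state [x] not covered by a coloured arc
   ends a maximal subtree hanging to the left of the spine, hence of sign [~~ x]. *)
Lemma sign_at_comb x r o v : comb x r -> o < v < o + arity r ->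
  (forall i j, o <= i < v -> v < j <= o + arity r -> arc_colour x r o i j = U) ->
  sign_at (arc_colour x r o) o v (v - o) = ~~ x.
Proof.
elim/tree_node_ind: r o => [|y l r _ IHr] o; first by rewrite /=; lia.
rewrite arity_node => + hv fU.
have l0 := arity_gt0 l; have r0 := arity_gt0 r.
(* A root type other than the state would colour the base, which covers [v]. *)
have [yx|yx] := eqVneq y x; last first.
  have := fU o (o + (arity l + arity r)); rewrite arc_colour_node !eqxx /= => root.
  have {root} : glue_colour (edge_colour x) (edge_colour (~~ y)) = U by apply: root; lia.
  by case: x y yx {fU IHr} => [] [].
subst y; rewrite comb_node => /andP[ul cr].
have inl i j : j <= o + arity l -> arc_colour x (node x l r) o i j = arc_colour (~~ x) l o i j.
  by move=> hj; rewrite arc_colour_node /split_colour ifF ?hj //; lia.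
have [vl|lv] := leqP v (o + arity l); last first.
  have -> : v - o = arity l + (v - (o + arity l)) by lia.
  rewrite sign_at_skip => [|i hi]; last by rewrite arc_colour_node /split_colour !ifF //; lia.
  have inr i j : o + arity l <= i -> i < j ->
      arc_colour x (node x l r) o i j = arc_colour x r (o + arity l) i j.
    by move=> hi hj; rewrite arc_colour_node /split_colour ifF; [rewrite ifF ?hi //|]; lia.
  rewrite -(IHr (o + arity l)) //; try lia.
    by apply: eq_sign_at => i hi; rewrite inr //; lia.
  by move=> i j hi hj; rewrite -inr; [apply: fU|..]; lia.
move: vl; rewrite leq_eqVlt => /predU1P[->|vl].
  rewrite -[RHS](sign_at_end (~~ x) l o) addKn.
  by apply: eq_sign_at => i _; rewrite inl.
(* A vertex inside [l] would be covered by the coloured base of [l]. *)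
have := fU o (o + arity l); rewrite inl // arc_colour_root => root.
have {root} : glue_colour (edge_colour (~~ x)) (base_colour l) = U by apply: root; lia.
by case: l x ul vl hv {l0 fU IHr cr inl} => [|? ?|? ?] [] //=; lia.
Qed.

Lemma normal_split s x l r l' r' o :
  normal (node x l r) -> normal (node x l' r') ->
  arity l + arity r = arity l' + arity r' ->
  arc_colour s (node x l r) o =2 arc_colour s (node x l' r') o -> arity l' <= arity l.
Proof.
rewrite !normal_node => /and3P[_ _ cr] /and3P[nl' _ _] ar eqF; rewrite leqNgt; apply/negP => ll'.
have l0 := arity_gt0 l; have r0 := arity_gt0 r; have r0' := arity_gt0 r'.
have inl i j : j <= o + arity l ->
    arc_colour s (node x l r) o i j = arc_colour (~~ x) l o i j.
  by move=> hj; rewrite arc_colour_node /split_colour ifF ?hj //; lia.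
have inl' i j : j <= o + arity l' ->
    arc_colour s (node x l r) o i j = arc_colour (~~ x) l' o i j.
  by move=> hj; rewrite eqF arc_colour_node /split_colour ifF ?hj //; lia.
have inr i j : o + arity l <= i -> i < j ->
    arc_colour s (node x l r) o i j = arc_colour x r (o + arity l) i j.
  by move=> hi hj; rewrite arc_colour_node /split_colour ifF; [rewrite ifF ?hi //|]; lia.
have crossU i j : o <= i < o + arity l -> o + arity l < j < o + (arity l + arity r) ->
    arc_colour s (node x l r) o i j = U.
  by move=> hi hj; rewrite arc_colour_node /split_colour ?ifF //; lia.
have sv : sign_at (arc_colour s (node x l r) o) o (o + arity l) (arity l) = ~~ x.
  rewrite -[RHS](sign_at_end (~~ x) l o).
  by apply: eq_sign_at => i _; rewrite inl.
(* The base of [l'] passes over the end of [l], so it is uncoloured and the root type of [l'] is its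
   state: [l'] splits into [e] in state [x] and [c] in state [~~ x]. *)
have l'U : glue_colour (edge_colour (~~ x)) (base_colour l') = U.
  by rewrite -(arc_colour_root _ _ o) -inl' // crossU //; lia.
have /typedP[e [c el']] : typed (~~ x) l'.
  by case: l' x l'U ll' {nl' eqF inl inl' inr crossU sv cr ar} => [|? ?|? ?] [] //=; lia.
subst l'; move: nl' ar ll' inl' l'U; rewrite normal_node arity_node.
move=> /and3P[_ _ cc] ar ll' inl' l'U.
have e0 := arity_gt0 e; have c0 := arity_gt0 c.
have ine i j : j <= o + arity e -> arc_colour s (node x l r) o i j = arc_colour x e o i j.
  move=> hj; rewrite inl' ?arc_colour_node /split_colour; last by lia.
  by rewrite ifF ?hj ?negbK //; lia.
have inc i j : o + arity e <= i -> i < j <= o + (arity e + arity c) ->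
    arc_colour s (node x l r) o i j = arc_colour (~~ x) c (o + arity e) i j.
  move=> hi hj; rewrite inl' ?arc_colour_node /split_colour; last by lia.
  by rewrite ifF; [rewrite ifF ?hi //|]; lia.
have se : sign_at (arc_colour s (node x l r) o) o (o + arity e) (arity e) = x.
  rewrite -[RHS](sign_at_end x e o).
  by apply: eq_sign_at => i _; rewrite ine.
(* Arcs over the end of [e] either lie in [l'], as its base or across its splitting, or pass over
   the end of [l']. *)
have crossU' i j : i < o + arity e < j -> o < i \/ j < o + (arity l + arity r) ->
    arc_colour s (node x l r) o i j = U.
  move=> hi hj; have [jl|lj] := leqP j (o + (arity e + arity c)).
    rewrite inl' // arc_colour_node /split_colour.
    case: ifP => h; last by rewrite ?ifF //; lia.
    by rewrite -[RHS]l'U; case: (x).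
  by rewrite eqF arc_colour_node /split_colour arity_node ?ifF //; lia.
(* [l] ends in state [~~ x] and [e] in state [x].  Whichever is longer, its end is an
   uncovered vertex of the comb following the shorter one ([r] after [l], [c] after
   [e]), which forces the other state there. *)
have [el|le|el] := ltngtP (arity e) (arity l); last first.
- by move: se; rewrite el sv; case: (x).
- have : sign_at (arc_colour x r (o + arity l)) (o + arity l) (o + arity e)
      (o + arity e - (o + arity l)) = ~~ x.
    apply: sign_at_comb => //; first by lia.
    by move=> i j hi hj; rewrite -inr ?crossU' //; lia.
  suff <- : sign_at (arc_colour s (node x l r) o) o (o + arity e) (arity e) =
      sign_at (arc_colour x r (o + arity l)) (o + arity l) (o + arity e)
        (o + arity e - (o + arity l)) by rewrite se; case: (x).
  rewrite subnDl -[X in sign_at _ _ _ X = _](subnKC (ltnW le)) sign_at_skip => [|i hi].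
    by apply: eq_sign_at => i hi; rewrite ?inr //; lia.
  by apply: crossU; lia.
- have : sign_at (arc_colour (~~ x) c (o + arity e)) (o + arity e) (o + arity l)
      (o + arity l - (o + arity e)) = ~~ ~~ x.
    apply: sign_at_comb => //; first by lia.
    by move=> i j hi hj; rewrite -inc ?crossU //; lia.
  suff <- : sign_at (arc_colour s (node x l r) o) o (o + arity l) (arity l) =
      sign_at (arc_colour (~~ x) c (o + arity e)) (o + arity e) (o + arity l)
        (o + arity l - (o + arity e)) by rewrite sv; case: (x).
  rewrite subnDl -[X in sign_at _ _ _ X = _](subnKC (ltnW el)) sign_at_skip => [|i hi].
    by apply: eq_sign_at => i hi; rewrite ?inc //; lia.
  by apply: crossU'; lia.
Qed.

Lemma glue_edge_inj s x y :
  glue_colour (edge_colour s) (edge_colour x) = glue_colour (edge_colour s) (edge_colour y) ->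
  x = y.
Proof. by case: s x y => [] [] []. Qed.

(** In a known state the base colour gives the root type, and [normal_split] used both ways gives
    the splitting vertex; the factors then have known states and offsets. *)
Lemma normal_inj s t t' o : normal t -> normal t' -> arity t = arity t' ->
  arc_colour s t o =2 arc_colour s t' o -> t = t'.
Proof.
elim/tree_node_ind: t t' s o => [|x l r IHl IHr] t' s o.
  elim/tree_node_ind: t' => [//|y l' r' _ _] _ _; rewrite arity_node.
  by have := arity_gt0 l'; have := arity_gt0 r' => /=; lia.
have r0 := arity_gt0 r; have l0 := arity_gt0 l.
elim/tree_node_ind: t' => [|y l' r' _ _]; first by rewrite arity_node /=; lia.
rewrite !arity_node => nt nt' ar eqF; have r0' := arity_gt0 r'; have l0' := arity_gt0 l'.
have xy : y = x.
  have := eqF o (o + (arity l + arity r)).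
  rewrite !arc_colour_node -ar !eqxx /= => /glue_edge_inj; by case: (x) (y) => [] [].
subst y; have al : arity l = arity l'.
  apply/eqP; rewrite eqn_leq; apply/andP; split.
    by apply: (normal_split s x l' r' l r o) => // a b; rewrite eqF.
  exact: (normal_split s x l r l' r' o).
move: nt nt'; rewrite !normal_node => /and3P[nl nr _] /and3P[nl' nr' _].
congr (node x _ _).
  apply: (IHl _ (~~ x) o) => // a b.
  have [ab|/negbTE ab] := boolP ((o <= a < b) && (b <= o + arity l)); last first.
    by rewrite !arc_colour_out -?al ?ab.
  have := eqF a b; rewrite !arc_colour_node /split_colour -al ifF; last by lia.
  rewrite ifT; last by lia.
  rewrite ifF; last by lia.
  by rewrite ifT //; lia.
apply: (IHr _ x (o + arity l)) => // [|a b]; first by lia.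
have [ab|/negbTE ab] := boolP ((o + arity l <= a < b) && (b <= o + arity l + arity r)); last first.
  have ar' : arity r = arity r' by lia.
  by rewrite !arc_colour_out -?ar' ?ab.
have := eqF a b; rewrite !arc_colour_node /split_colour -al.
do 2 (rewrite ifF; last by lia).
rewrite ifT; last by lia.
do 2 (rewrite ifF; last by lia).
by rewrite ifT //; lia.
Qed.

(** * Image and kernel of the evaluation *)

Lemma arity_ev t : bnc_size (ev t) = arity t.
Proof. by rewrite ev_arc_colour. Qed.

Lemma ev_graft t i s : 1 <= i <= arity t -> ev (graft t i s) = ocomp (ev t) i (ev s).
Proof. by move=> hi; rewrite !ev_arc_colour ocomp_arc_colour. Qed.

Lemma genO_ev t : genO (ev t).
Proof.
have g x l r : genO (ev (node x Leaf Leaf)) -> genO (ev l) -> genO (ev r) ->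
    genO (ev (node x l r)).
  move=> gx gl gr; have := arity_gt0 r => r0.
  have x2 : arity (node x Leaf Leaf) = 2 by case: (x).
  have a2 : arity (graft (node x Leaf Leaf) 2 r) = (arity r).+1.
    by rewrite arity_graft x2; lia.
  rewrite node_graft ev_graft ?a2 //.
  apply: genO_comp; rewrite ?arity_ev ?a2 //.
  by rewrite ev_graft ?x2 //; apply: genO_comp; rewrite ?arity_ev ?x2.
elim/tree_node_ind: t => [|x l r gl gr]; first exact: genO_unit.
by apply: g => //; case: x; [exact: genO_p|exact: genO_q].
Qed.

Lemma ev_cong t t' : cong t t' -> ev t = ev t'.
Proof.
elim=> {t t'} //.
- by move=> t t' t'' _ -> _ ->.
- move=> t t' i s _ e hi; rewrite !ev_graft ?e //.
  by rewrite -arity_ev -e arity_ev.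
- by move=> t i s s' _ e hi; rewrite !ev_graft ?e.
Qed.

Lemma normal_ev_inj t t' : normal t -> normal t' -> ev t = ev t' -> t = t'.
Proof.
move=> nt nt' e; have ar : arity t = arity t' by rewrite -!arity_ev e.
apply: (@normal_inj false _ _ 1) => // a b.
have [ab|ab] := boolP ((1 <= a < b) && (b <= 1 + arity t)); last first.
  by rewrite !arc_colour_out -?ar.
have := congr1 (fun c => col c a b) e.
by rewrite !ev_arc_colour !col_mkBNC -ar -add1n ab.
Qed.

Theorem theorem3p15 :
  (* ev is an operad morphism from the free operad into CNCB *)
  (forall t, bnc_size (ev t) = arity t) /\
  (forall t i s, 1 <= i <= arity t -> ev (graft t i s) = ocomp (ev t) i (ev s)) /\
  (* its image is exactly the suboperad O generated by p and q *)
  (forall c, genO c <-> exists t, ev t = c) /\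
  (* its kernel is exactly the operadic congruence generated by the relations *)
  (forall t t', ev t = ev t' <-> cong t t').
Proof.
split; first exact: arity_ev.
split; first exact: ev_graft.
split=> [c|t t'].
  split=> [|[t <-]]; last exact: genO_ev.
  elim=> {c} [|||C D i _ [t <-] _ [u <-]]; first by exists Leaf.
  - by exists gp.
  - by exists gq.
  - by rewrite arity_ev => hi; exists (graft t i u); rewrite ev_graft.
split=> [e|]; last exact: ev_cong.
have [u tu nu] := normal_exists t; have [u' tu' nu'] := normal_exists t'.
have uu' : u = u' by apply: normal_ev_inj; rewrite // -(ev_cong _ _ tu) -(ev_cong _ _ tu').
by apply: cong_trans tu _; rewrite uu'; exact: cong_sym.
Qed.
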